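(* Fix a real parameter $k>0$. Let $W=\ell_1\ell_2\cdots\ell_\tau$ be a word of length $\tau\ge 3$ over the alphabet $\{\mathtt{P},\mathtt{C},\mathtt{E}\}$, and let $W^T$ be its toggling. Then the weighted graphs $G(W)$ and $G(W^T)$ are cospectral with respect to the normalized Laplacian, i.e. their normalized Laplacian matrices have the same characteristic polynomial.
   Context: For an edge-weighted graph with symmetric non-negative weights $w(i,j)$, the degree is $d_i=\sum_{j\sim i}w(i,j)$. The normalized Laplacian $\mathcal{L}$ has $\mathcal{L}(i,i)=1$ if vertex $i$ is not isolated, $\mathcal{L}(i,j)=-w(i,j)/\sqrt{d_id_j}$ if $i\sim j$, and $0$ otherwise. Modules (each has two distinguished ''signed'' vertices, labelled $+$ and $-$): - $\mathtt{P}$: a path $x,+,-,y$ on four vertices with $w(x,+)=k$, $w(+,-)=1$, $w(-,y)=k$. - $\mathtt{C}$: a 4-cycle $x,+,-,y,x$ with $w(x,+)=k$, $w(+,-)=1$, $w(-,y)=k$, $w(y,x)=k^2$. - $\mathtt{E}$: a single edge between $+$ and $-$ of weight $k+1$. Given a word $W=\ell_1\cdots\ell_\tau$ with $\tau\ge3$, $G(W)$ is obtained by taking a copy of the module $\ell_i$ for each $i$ and, for each $i$ (indices modulo $\tau$), identifying the $+$ vertex of the $i$-th module with the $-$ vertex of the $(i+1)$-th module; in particular the $+$ vertex of the last module is identified with the $-$ vertex of the first. Thus the modules form a ring, and each signed vertex has degree $2(k+1)$. The toggling $W^T$ of $W$ is the word obtained by replacing every $\mathtt{P}$ by $\mathtt{C}$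 and every $\mathtt{C}$ by $\mathtt{P}$, leaving every $\mathtt{E}$ unchanged. *)

(* Defs.v *)
From HB Require Import structures.
From mathcomp Require Import all_boot all_order all_algebra.

Set Implicit Arguments.
Unset Strict Implicit.
Unset Printing Implicit Defensive.

Import Order.TTheory GRing.Theory Num.Theory.
Local Open Scope ring_scope.

(* An edge-weighted graph on V is given by its weight function w; a pair of
   vertices is an edge exactly when its weight is nonzero. *)
Section WeightedGraph.
Variables (R : rcfType) (V : finType) (w : V -> V -> R).

Definition adjacent (u v : V) : bool := w u v != 0.

Definition isolated (u : V) : bool := ~~ [exists v, adjacent u v].

Definition degree (u : V) : R := \sum_(v | adjacent u v) w u v.

Definition normalized_laplacian_entry (u v : V) : R :=
  if u == v then (if isolated u then 0 else 1)
  else if adjacent u v then - (w u v / Num.sqrt (degree u * degree v))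
  else 0.

Definition normalized_laplacian : 'M[R]_#|V| :=
  \matrix_(i, j) normalized_laplacian_entry (enum_val i) (enum_val j).

End WeightedGraph.

Definition cospectral (R : rcfType) (V V' : finType)
    (w : V -> V -> R) (w' : V' -> V' -> R) : Prop :=
  char_poly (normalized_laplacian w) = char_poly (normalized_laplacian w').

Inductive letter := LP | LC | LE.

Inductive mvertex := Plus | Minus | X | Y.

Definition mvertex_to_pair (a : mvertex) : bool * bool :=
  match a with
  | Plus => (true, true) | Minus => (true, false)
  | X => (false, true) | Y => (false, false)
  end.

Definition mvertex_of_pair (p : bool * bool) : mvertex :=
  match p with
  | (true, true) => Plus | (true, false) => Minus
  | (false, true) => X | (false, false) => Y
  end.

Lemma mvertex_to_pairK : cancel mvertex_to_pair mvertex_of_pair.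
Proof. by case. Qed.

HB.instance Definition _ := Equality.copy mvertex (can_type mvertex_to_pairK).
HB.instance Definition _ := Choice.copy mvertex (can_type mvertex_to_pairK).
HB.instance Definition _ := Countable.copy mvertex (can_type mvertex_to_pairK).
HB.instance Definition _ : isFinite mvertex := CanIsFinite mvertex_to_pairK.

Definition module_vertices (l : letter) : {set mvertex} :=
  if l is LE then [set Plus; Minus] else [set: mvertex].

Definition module_weight (R : rcfType) (k : R) (l : letter) (a b : mvertex) : R :=
  match l, a, b with
  | LE, Plus, Minus | LE, Minus, Plus => k + 1
  | LE, _, _ => 0
  | _, X, Plus | _, Plus, X => k
  | _, Plus, Minus | _, Minus, Plus => 1
  | _, Minus, Y | _, Y, Minus => k
  | LC, Y, X | LC, X, Y => k ^+ 2
  | _, _, _ => 0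
  end.

Definition toggle_letter (l : letter) : letter :=
  match l with LP => LC | LC => LP | LE => LE end.

Definition toggle (tau : nat) (W : tau.-tuple letter) : tau.-tuple letter :=
  map_tuple toggle_letter W.

(* The pair (i, a) stands for the vertex a of the i-th module.  Identified
   vertices get the same representative: the - vertex of a module is
   represented by the + vertex of the (cyclically) preceding one. *)
Definition glue (tau : nat) (p : 'I_tau * mvertex) : 'I_tau * mvertex :=
  if p.2 is Minus then (ord_pred p.1, Plus) else p.

Definition vertex_set (tau : nat) (W : tau.-tuple letter) :
    {set 'I_tau * mvertex} :=
  [set glue p | p : 'I_tau * mvertex & p.2 \in module_vertices (tnth W p.1)].

Definition vertex (tau : nat) (W : tau.-tuple letter) : finType :=
  {p : 'I_tau * mvertex | p \in vertex_set W}.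

(* For tau >= 3 no two edges of distinct modules are identified, so at most one
   term of this sum is nonzero. *)
Definition G (R : rcfType) (k : R) (tau : nat) (W : tau.-tuple letter)
    (u v : vertex W) : R :=
  \sum_(i < tau) \sum_a \sum_(b | (glue (i, a) == val u) && (glue (i, b) == val v))
    module_weight k (tnth W i) a b.

(* Main.v *)
(** For [z] the spectral parameter minus one, eliminating the unsigned vertices
    (a Schur complement) turns the module [i] into a symmetric 2x2 block
    [[b_i, a_i], [a_i, b_i]] on its two signed vertices, and the characteristic
    polynomial into the determinant of the cyclic matrix [T(b, a)] obtained by
    gluing these blocks.  A planar-type duality holds for such rings: [T(b, a)]
    is, up to an orthogonal change of basis, a corner of a 2t x 2t matrix whose
    inverse has [T(b/d, a/d)], [d_i = b_i^2 - a_i^2], in the opposite corner, so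
    Jacobi's complementary minor formula gives
    [det T(b, a) = (\prod_i d_i) * det T(b/d, a/d)].  Up to one scalar
    [(k+1)^2(z^2-1)], the same for all three letters, dividing by [d] exchanges
    the blocks of [P] and [C] and fixes the block of [E]. *)

Require Import Defs.
From mathcomp Require Import all_boot all_order all_algebra all_fingroup.
From mathcomp Require Import ring lra.

Set Implicit Arguments.
Unset Strict Implicit.
Unset Printing Implicit Defensive.

Import Order.TTheory GRing.Theory Num.Theory.
Local Open Scope ring_scope.

(** * Polynomial identities from values, and tools for determinants *)

Lemma horner_char_poly (R : comNzRingType) n (A : 'M[R]_n) x :
  (char_poly A).[x] = \det (x%:M - A).
Proof.
rewrite -[LHS]/(horner_eval x _) -det_map_mx; congr (\det _).
apply/matrixP => i j.
by rewrite !mxE rmorphB rmorphMn /= /horner_eval hornerX hornerC.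
Qed.

(** The difference vanishes at c+1, c+2, ..., and as many of these points as its size exceed its
    degree. This permits arguing only at large [x], away from every pole. *)
Lemma eq_poly_gt (R : realDomainType) (c : R) (p q : {poly R}) :
  (forall x, c < x -> p.[x] = q.[x]) -> p = q.
Proof.
move=> eq_pq; apply/eqP; rewrite -subr_eq0; apply/eqP.
pose s := [seq c + n.+1%:R | n <- iota 0 (size (p - q))].
apply: (@roots_geq_poly_eq0 _ _ s).
- apply/allP => _ /mapP[n _ ->]; rewrite rootE hornerD hornerN eq_pq ?subrr //.
  by rewrite ltrDl ltr0Sn.
- rewrite map_inj_uniq ?iota_uniq // => m n /addrI/eqP.
  by rewrite eqr_nat => /eqP[].
- by rewrite size_map size_iota.
Qed.

(** Rows and columns undergo the same permutation, whose sign is squared. *)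
Lemma det_mxsub_bij (R : comNzRingType) n m (A : 'M[R]_m) (f : 'I_n -> 'I_m) :
  bijective f -> \det (mxsub f f A) = \det A.
Proof.
move=> bij_f; have eq_nm : n = m by rewrite -[n]card_ord (bij_eq_card bij_f) card_ord.
move: A f bij_f; case: m / eq_nm => A f /bij_inj inj_f.
have -> : mxsub f f A = row_perm (perm inj_f) (col_perm (perm inj_f) A).
  by apply/matrixP => i j; rewrite !mxE !permE.
rewrite row_permE col_permE !det_mulmx !det_perm odd_permV mulrCA.
by rewrite -expr2 sqrr_sign mulr1.
Qed.

(** Listing the image of [phi] first makes the matrix block diagonal, with an identity block on the
    complement. *)
Lemma det_pad_identity (R : comNzRingType) (V : finType) m (A : 'M[R]_m)
    (phi : V -> 'I_m) :
  injective phi ->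
  (forall i j, i \notin codom phi -> A i j = (i == j)%:R /\ A j i = (i == j)%:R) ->
  \det A = \det (\matrix_(i, j < #|V|) A (phi (enum_val i)) (phi (enum_val j))).
Proof.
move=> inj_phi padA; pose C := [predC codom phi].
pose f (i : 'I_(#|V| + #|C|)) := match split i with
  | inl a => phi (enum_val a) | inr b => enum_val b end.
have Cf b : (enum_val b : 'I_m) \notin codom phi := @enum_valP _ C b.
have inj_f : injective f.
  move=> i j; rewrite /f -{2}[i]splitK -{2}[j]splitK.
  case: (split i) => a; case: (split j) => b.
  - by move=> /inj_phi/enum_val_inj->.
  - by move=> e; have := Cf b; rewrite -e codom_f.
  - by move=> e; have := Cf a; rewrite e codom_f.
  - by move=> /enum_val_inj->.
have bij_f : bijective f.
  apply: inj_card_bij => //; rewrite !card_ord -(card_codom inj_phi).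
  by rewrite cardC card_ord.
rewrite -(det_mxsub_bij A bij_f).
set B := \matrix_(i, j) _; have -> : mxsub f f A = block_mx B 0 0 1%:M.
  apply/matrixP => i j; rewrite !mxE /f.
  case: (split i) => a; rewrite !mxE; case: (split j) => b; rewrite !mxE //.
  - rewrite (padA _ _ (Cf b)).2; case: eqP => // e.
    by have := Cf b; rewrite e codom_f.
  - rewrite (padA _ _ (Cf a)).1; case: eqP => // e.
    by have := Cf a; rewrite e codom_f.
  - by rewrite (padA _ _ (Cf a)).1 (inj_eq enum_val_inj).
by rewrite det_ublock det1 mulr1.
Qed.

(** Jacobi: multiplying [A] by the identity matrix with its right block column replaced by that of
    [A'] turns the right block column of [A] into that of the identity. *)
Lemma det_complementary_minor (R : comNzRingType) m n (A A' : 'M[R]_(m + n)) :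
  A *m A' = 1%:M -> \det A * \det (drsubmx A') = \det (ulsubmx A).
Proof.
rewrite -{1}[A]submxK -{1}[A']submxK mulmx_block (scalar_mx_block m n 1).
case/eq_block_mx => _ AA'12 _ AA'22.
have := congr1 (@determinant _ _) (mulmx_block (ulsubmx A) (ursubmx A)
  (dlsubmx A) (drsubmx A) 1%:M (ursubmx A') 0 (drsubmx A')).
rewrite AA'12 AA'22 !mulmx1 !mulmx0 !addr0 det_mulmx det_ublock det1 mul1r.
by rewrite submxK det_lblock det1 mulr1.
Qed.

(** * Ring matrices and their duality *)

Section RingMatrix.
Variables (R : fieldType) (t : nat) (P : 'M[R]_t).
Hypothesis two_neq0 : 2%:R != 0 :> R.

Definition dmx (f : 'I_t -> R) : 'M[R]_t := diag_mx (\row_i f i).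

Lemma dmxD f g : dmx (fun i => f i + g i) = dmx f + dmx g.
Proof. by rewrite -raddfD; congr diag_mx; apply/rowP => i; rewrite !mxE. Qed.

Lemma dmxN f : dmx (fun i => - f i) = - dmx f.
Proof. by rewrite -raddfN; congr diag_mx; apply/rowP => i; rewrite !mxE. Qed.

Lemma dmxM f g : dmx (fun i => f i * g i) = dmx f *m dmx g.
Proof. by rewrite mulmx_diag; congr diag_mx; apply/rowP => i; rewrite !mxE. Qed.

Lemma dmx1 : dmx (fun=> 1) = 1%:M.
Proof. by rewrite -diag_const_mx; congr diag_mx; apply/rowP => i; rewrite !mxE. Qed.

Lemma eq_dmx f g : f =1 g -> dmx f = dmx g.
Proof. by move=> e; congr diag_mx; apply/rowP => i; rewrite !mxE e. Qed.

Lemma det_dmx f : \det (dmx f) = \prod_i f i.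
Proof. by rewrite det_diag; apply: eq_bigr => i _; rewrite mxE. Qed.

(** Sum over i of the block [[b_i, a_i], [a_i, b_i]] placed on the vectors e_i and P e_i, which
    stand for the + and - vertices of module i. *)
Definition ring_mx (b a : 'I_t -> R) : 'M[R]_t :=
  dmx b + P *m dmx b *m P^T + dmx a *m P^T + P *m dmx a.

(** Each 2x2 block splits along its eigenvectors (1, 1) and (1, -1), with eigenvalues 2u and 2v. *)
Lemma ring_mx_sym_antisym (u v : 'I_t -> R) :
  (1%:M + P) *m dmx u *m (1%:M + P)^T + (1%:M - P) *m dmx v *m (1%:M - P)^T =
  ring_mx (fun i => u i + v i) (fun i => u i - v i).
Proof.
rewrite /ring_mx !dmxD dmxN linearD linearB /= tr_scalar_mx.
rewrite !(mulmxDl, mulmxDr, mul1mx, mulmx1, mulNmx, mulmxN, opprK).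
by apply/matrixP => i j; rewrite !mxE; ring.
Qed.

Lemma ring_mxZ e b a :
  ring_mx (fun i => e * b i) (fun i => e * a i) = e *: ring_mx b a.
Proof.
have dmxZ f : dmx (fun i => e * f i) = e *: dmx f.
  by rewrite -linearZ; congr diag_mx; apply/rowP => i; rewrite !mxE.
by rewrite /ring_mx !dmxZ !scalerDr -!(scalemxAl, scalemxAr).
Qed.

Hypothesis PP : P *m P^T = 1%:M.

(** Up to the factor 1/4, both ring matrices are opposite corners of [Q D Q^T] and of its inverse.
    The roles of u and v are exchanged because [A] and [B] trade places between the two corners. *)
Lemma det_ring_mx_dual (u v : 'I_t -> R) :
  (forall i, u i != 0) -> (forall i, v i != 0) ->
  \det (ring_mx (fun i => u i + v i) (fun i => u i - v i)) =
  (\prod_i (u i * v i)) * \det (ring_mx (fun i => (v i)^-1 + (u i)^-1)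
                              (fun i => (v i)^-1 - (u i)^-1)).
Proof.
move=> u0 v0; rewrite -ring_mx_sym_antisym.
rewrite -(ring_mx_sym_antisym (fun i => (v i)^-1) (fun i => (u i)^-1)).
set A := 1%:M + P; set B := 1%:M - P.
(* Orthogonal, since A A^T + B B^T = 2(1 + P P^T) = 4 and A B^T + B A^T = 2(1 - P P^T) = 0. *)
pose Q := 2^-1 *: block_mx A B B A.
have QQ : Q *m Q^T = 1%:M.
  rewrite /Q linearZ /= -scalemxAl -scalemxAr scalerA tr_block_mx mulmx_block.
  rewrite /A /B !(linearD, linearN) /= !tr_scalar_mx.
  rewrite !(mulmxDl, mulmxDr, mul1mx, mulmx1, mulNmx, mulmxN, opprK, PP).
  rewrite scale_block_mx (scalar_mx_block t t 1).
  by congr block_mx; apply/matrixP => i j; rewrite !mxE; field.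
pose D := block_mx (dmx u) 0 0 (dmx v).
pose D' := block_mx (dmx (fun i => (u i)^-1)) 0 0 (dmx (fun i => (v i)^-1)).
have DD' : D *m D' = 1%:M.
  rewrite mulmx_block !mulmx0 !mul0mx !addr0 !add0r -!dmxM (scalar_mx_block t t 1).
  by rewrite -!dmx1; congr block_mx; apply: eq_dmx => i; rewrite divff.
have inv : (Q *m D *m Q^T) *m (Q *m D' *m Q^T) = 1%:M.
  rewrite !mulmxA -(mulmxA _ Q^T Q) (mulmx1C QQ) mulmx1 -(mulmxA Q D D') DD'.
  by rewrite mulmx1.
pose c : R := 2^-1 * 2^-1.
have c0 : c != 0 by rewrite mulf_neq0 ?invr_neq0.
have QDQ E F : Q *m block_mx (dmx E) 0 0 (dmx F) *m Q^T =
    block_mx (c *: (A *m dmx E *m A^T + B *m dmx F *m B^T))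
             (c *: (A *m dmx E *m B^T + B *m dmx F *m A^T))
             (c *: (B *m dmx E *m A^T + A *m dmx F *m B^T))
             (c *: (B *m dmx E *m B^T + A *m dmx F *m A^T)).
  rewrite /Q linearZ /= -!scalemxAl -scalemxAr scalerA tr_block_mx !mulmx_block.
  by rewrite !mulmx0 !addr0 !add0r scale_block_mx.
have detQDQ : \det (Q *m D *m Q^T) = \prod_i (u i * v i).
  rewrite -[_ *m Q^T]mulmxA det_mulmx mulrC -det_mulmx -mulmxA (mulmx1C QQ) mulmx1.
  by rewrite det_ublock !det_dmx big_split.
have := det_complementary_minor inv.
rewrite detQDQ !QDQ block_mxKdr block_mxKul !detZ mulrCA.
by move/(mulfI (expf_neq0 _ c0)) => <-; rewrite addrC.
Qed.

(** The duality in terms of the block entries: with d = b^2 - a^2 = 4uv, the hypotheses say b' = e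
    b/d = (e/4)(1/v + 1/u) and a' = e a/d = (e/4)(1/v - 1/u). *)
Lemma det_ring_mx_toggle (b a b' a' : 'I_t -> R) (e : R) :
  e != 0 -> (forall i, b i ^+ 2 - a i ^+ 2 != 0) ->
  (forall i, b' i * (b i ^+ 2 - a i ^+ 2) = e * b i) ->
  (forall i, a' i * (b i ^+ 2 - a i ^+ 2) = e * a i) ->
  e ^+ t * \det (ring_mx b a) =
  (\prod_i (b i ^+ 2 - a i ^+ 2)) * \det (ring_mx b' a').
Proof.
move=> e0 d0 eb ea.
pose u i := (b i + a i) / 2; pose v i := (b i - a i) / 2.
have four0 : 4 != 0 :> R by rewrite (natrM R 2 2) mulf_neq0.
have bE i : b i = u i + v i by rewrite /u /v; field; rewrite two_neq0.
have aE i : a i = u i - v i by rewrite /u /v; field; rewrite two_neq0.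
have dE i : b i ^+ 2 - a i ^+ 2 = 4 * (u i * v i) by rewrite bE aE; ring.
have uv0 i : u i * v i != 0.
  by apply: contraNneq (d0 i) => uv0; rewrite dE uv0 mulr0.
have u0 i : u i != 0 by apply: contraNneq (uv0 i) => ->; rewrite mul0r.
have v0 i : v i != 0 by apply: contraNneq (uv0 i) => ->; rewrite mulr0.
have -> : ring_mx b a = ring_mx (fun i => u i + v i) (fun i => u i - v i).
  by rewrite /ring_mx (eq_dmx bE) (eq_dmx aE).
have b'E i : b' i = e / 4 * ((v i)^-1 + (u i)^-1).
  by apply: (mulIf (d0 i)); rewrite eb dE bE; field; rewrite ?four0 ?u0 ?v0.
have a'E i : a' i = e / 4 * ((v i)^-1 - (u i)^-1).
  by apply: (mulIf (d0 i)); rewrite ea dE aE; field; rewrite ?four0 ?u0 ?v0.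
have -> : ring_mx b' a' = (e / 4) *:
    ring_mx (fun i => (v i)^-1 + (u i)^-1) (fun i => (v i)^-1 - (u i)^-1).
  by rewrite -ring_mxZ /ring_mx (eq_dmx b'E) (eq_dmx a'E).
rewrite det_ring_mx_dual // detZ !mulrA; congr (_ * _).
rewrite (eq_bigr _ (fun i _ => dE i)) [in RHS]big_split /= prodr_const card_ord.
by rewrite mulrAC -exprMn mulrCA divff // mulr1.
Qed.

(** The matrix before elimination: signed vertices first, then all X, then all Y. The weight c_i
    ties X to e_i and Y to P e_i; p and q fill the block on X and Y. *)
Definition module_mx (b a c p q : 'I_t -> R) : 'M[R]_(t + (t + t)) :=
  block_mx (ring_mx b a) (row_mx (dmx c) (P *m dmx c))
           (col_mx (dmx c) (dmx c *m P^T))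
           (block_mx (dmx p) (dmx q) (dmx q) (dmx p)).

End RingMatrix.

(** * Elimination of the unsigned vertices *)

Section SchurComplement.
Variables (R : fieldType) (t : nat) (P : 'M[R]_t).

(** A unipotent conjugation makes the matrix block triangular, with diagonal p + q and p - q. *)
Lemma det_sym_block (p q : 'I_t -> R) :
  \det (block_mx (dmx p) (dmx q) (dmx q) (dmx p)) =
  \prod_i (p i ^+ 2 - q i ^+ 2).
Proof.
have e : block_mx (dmx p) (dmx q) (dmx q) (dmx p) *m block_mx 1%:M (- 1%:M) 0 1%:M =
   block_mx 1%:M (- 1%:M) 0 1%:M *m
    block_mx (dmx (fun i => p i + q i)) 0 (dmx q) (dmx (fun i => p i - q i)).
  rewrite !mulmx_block !mulmx1 !mul1mx !mulmx0 !mul0mx !mulmxN !mulNmx !mulmx1 !mul1mx.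
  rewrite dmxD dmxD dmxN !addr0 !add0r.
  congr block_mx; apply/matrixP => i j; rewrite !mxE; ring.
have := congr1 (@determinant _ _) e.
rewrite !det_mulmx !det_ublock !det1 !mulr1 !mul1r => ->.
rewrite det_lblock !det_dmx -big_split /=; apply: eq_bigr => i _; ring.
Qed.

Lemma det_module_mx (b a c p q : 'I_t -> R) :
  (forall i, p i ^+ 2 - q i ^+ 2 != 0) ->
  \det (module_mx P b a c p q) =
  (\prod_i (p i ^+ 2 - q i ^+ 2)) *
  \det (ring_mx P (fun i => b i - c i ^+ 2 * p i / (p i ^+ 2 - q i ^+ 2))
                  (fun i => a i + c i ^+ 2 * q i / (p i ^+ 2 - q i ^+ 2))).
Proof.
move=> d0; pose m i := - (p i * c i) / (p i ^+ 2 - q i ^+ 2).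
pose n i := (q i * c i) / (p i ^+ 2 - q i ^+ 2).
(* Minus the inverse of the lower right block times the lower left one, so that column elimination
   clears the lower left corner. *)
pose Y := col_mx (dmx m + dmx n *m P^T) (dmx n + dmx m *m P^T).
rewrite -det_sym_block mulrC -(det_ublock _ (row_mx (dmx c) (P *m dmx c))).
set L := RHS; rewrite -[LHS]mulr1 -[1](_ : \det (block_mx 1%:M 0 Y 1%:M) = 1); last first.
  by rewrite det_lblock !det1 mulr1.
rewrite -det_mulmx {}/L; congr (\det _).
rewrite mulmx_block !mulmx1 !mulmx0 !add0r; congr block_mx.
- rewrite mul_row_col /ring_mx.
  have eb i : b i - c i ^+ 2 * p i / (p i ^+ 2 - q i ^+ 2) = b i + c i * m i.
    by rewrite /m; field.
  have ea i : a i + c i ^+ 2 * q i / (p i ^+ 2 - q i ^+ 2) = a i + c i * n i.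
    by rewrite /n; field.
  rewrite (eq_dmx eb) (eq_dmx ea).
  rewrite !dmxD !dmxM.
  rewrite !(mulmxDl, mulmxDr, mulmxA).
  apply/matrixP => i j; rewrite !mxE; ring.
- rewrite mul_block_col !mulmxDr !mulmxA -!dmxM add_col_mx.
  have -> : dmx (fun i => p i * m i) = - dmx c - dmx (fun i => q i * n i).
    rewrite -dmxN -[- dmx (fun i => q i * n i)]dmxN -dmxD; apply: eq_dmx => i.
    by rewrite /m /n; field.
  have -> : dmx (fun i => p i * n i) = - dmx (fun i => q i * m i).
    by rewrite -dmxN; apply: eq_dmx => i; rewrite /m /n; field.
  by rewrite -col_mx0 !(mulmxBl, mulNmx); congr col_mx;
    apply/matrixP => i j; rewrite !mxE; ring.
Qed.
End SchurComplement.

(** * Sums over module vertices and sums with a single surviving index *)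

Lemma big_mvertex (S : Type) (idx : S) (op : Monoid.com_law idx) (F : mvertex -> S) :
  \big[op/idx]_a F a = op (op (F Plus) (F Minus)) (op (F X) (F Y)).
Proof.
rewrite (bigD1 Plus) //= (bigD1 Minus) //= (bigD1 X) //= (bigD1 Y) //= big1.
  by rewrite Monoid.mulm1 -!Monoid.mulmA.
by case.
Qed.

Lemma sum_if_eq (S : nmodType) (I : finType) (i : I) (b : I -> bool) (F : I -> S) :
  \sum_l (if (l == i) && b l then F l else 0) = if b i then F i else 0.
Proof. by rewrite -big_mkcond big_mkcondr big_pred1_eq. Qed.

Lemma sum_if_eqr (S : nmodType) (I : finType) (i : I) (b : I -> bool) (F : I -> S) :
  \sum_l (if b l && (l == i) then F l else 0) = if b i then F i else 0.
Proof. by under eq_bigr do rewrite andbC; apply: sum_if_eq. Qed.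

Lemma sum_if_pred1 (S : nmodType) (I : finType) (i : I) (F : I -> S) :
  \sum_l (if l == i then F l else 0) = F i.
Proof. by rewrite -big_mkcond big_pred1_eq. Qed.

Lemma sum_if_pred1_sym (S : nmodType) (I : finType) (i : I) (F : I -> S) :
  \sum_l (if i == l then F l else 0) = F i.
Proof. by under eq_bigr do rewrite eq_sym; apply: sum_if_pred1. Qed.

Definition block_mx_entriesE := (block_mxEul, block_mxEur, block_mxEdl, block_mxEdr,
  row_mxEl, row_mxEr, col_mxEu, col_mxEd).

(** * Edge weights and degrees of the ring of modules *)

Section LetterWeights.
Variables (R : rcfType) (k : R).

(** All three modules are treated as one 4-cycle with possibly vanishing weights: [LP] lacks the
    outer edge, [LE] the spokes as well. *)
Definition signed_weight (l : letter) : R := if l is LE then k + 1 else 1.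
Definition spoke_weight (l : letter) : R := if l is LE then 0 else k.
Definition outer_weight (l : letter) : R := if l is LC then k ^+ 2 else 0.

Lemma module_weightE l a b : module_weight k l a b =
  match a, b with
  | Plus, Minus | Minus, Plus => signed_weight l
  | Plus, X | X, Plus | Minus, Y | Y, Minus => spoke_weight l
  | X, Y | Y, X => outer_weight l
  | _, _ => 0
  end.
Proof. by case: l a b => [] [] []. Qed.

Variables (t : nat) (W : t.-tuple letter).

(** Closed form of [G] on representatives. Between signed vertices the two terms are the +- edges of
    modules i and j, each joining an index to its predecessor. *)
Definition weight (p q : 'I_t * mvertex) : R :=
  let: (i, a) := p in let: (j, b) := q in
  match a, b with
  | Plus, Plus => (if ord_pred i == j then signed_weight (tnth W i) else 0) +
                  (if ord_pred j == i then signed_weight (tnth W j) else 0)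
  | Plus, X => if i == j then spoke_weight (tnth W j) else 0
  | X, Plus => if i == j then spoke_weight (tnth W i) else 0
  | Plus, Y => if ord_pred j == i then spoke_weight (tnth W j) else 0
  | Y, Plus => if ord_pred i == j then spoke_weight (tnth W i) else 0
  | X, Y | Y, X => if i == j then outer_weight (tnth W i) else 0
  | _, _ => 0
  end.

Lemma in_vertex_set i a : ((i, a) \in vertex_set W) =
  match a with
  | Plus => true | Minus => false
  | X | Y => if tnth W i is LE then false else true
  end.
Proof.
apply/imsetP/idP => [[[j b]]|].
  rewrite inE /=; case: b => /= h [-> ->] //; move: h; case: (tnth W j) => //=;
  by rewrite !inE.
case: a => // h.
- by exists (i, Plus) => //; rewrite inE /=; case: (tnth W i); rewrite !inE.
- by exists (i, X) => //; rewrite inE /=; case: (tnth W i) h; rewrite ?inE.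
- by exists (i, Y) => //; rewrite inE /=; case: (tnth W i) h; rewrite ?inE.
Qed.

Lemma G_weight (u v : vertex W) : G k u v = weight (val u) (val v).
Proof.
case: u v => [[i a] /= hu] [[j b] /= hv]; rewrite /G /=.
move: hu hv; rewrite !in_vertex_set.
under eq_bigr => l _.
  rewrite big_mvertex.
  do 4 rewrite big_mkcond big_mvertex /=.
  rewrite /glue /= !module_weightE !xpair_eqE.
  over.
case: a => // hu; case: b => // hv /=; rewrite /eq_op /=.
all: under eq_bigr => l _ do rewrite ?(andbF, andbT) ?(addr0, add0r, if_same).
all: rewrite ?big_split /=.
all: rewrite ?sum_if_eq ?sum_if_eqr ?big1_eq //.
all: by case: eqP => // /val_inj ->.
Qed.

Definition mdegree (p : 'I_t * mvertex) : R :=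
  if p.2 is Plus then 2 * (k + 1)
  else spoke_weight (tnth W p.1) + outer_weight (tnth W p.1).

Lemma val_not_minus (v : vertex W) : (val v).2 != Minus.
Proof. by case: v => [[i []]] //=; rewrite in_vertex_set. Qed.

Lemma big_vertex (S : Type) (idx : S) (op : Monoid.com_law idx)
    (F : 'I_t * mvertex -> S) :
  \big[op/idx]_(v : vertex W) F (val v) =
  \big[op/idx]_i (op (F (i, Plus))
     (if tnth W i is LE then idx else op (F (i, X)) (F (i, Y)))).
Proof.
have <- : \big[op/idx]_(p in vertex_set W) F p = \big[op/idx]_(v : vertex W) F (val v).
  exact: big_sub.
rewrite big_mkcond.
rewrite (eq_bigr (fun p => if (p.1, p.2) \in vertex_set W then F (p.1, p.2) else idx)).
  rewrite -(pair_bigA _ (fun i a => if (i, a) \in vertex_set W then F (i, a) else idx)).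
  apply: eq_bigr => i _; rewrite big_mvertex !in_vertex_set Monoid.mulm1.
  by case: (tnth W i); rewrite ?Monoid.mulm1.
by case.
Qed.

(** Lets degree sums run over X and Y of every module, including those absent from [LE]. *)
Lemma weight_noE i j a : tnth W j = LE -> a \in [:: X; Y] ->
  weight i (j, a) = 0.
Proof.
case: i => i b e; rewrite !inE => /orP[] /eqP -> /=; case: b => //=; case: eqP => // ij;
by rewrite ?ij ?e.
Qed.

(** Every module gives k + 1 to each of its signed vertices, so their degree does not depend on the
    word. *)
Lemma signedD_spoke l : signed_weight l + spoke_weight l = k + 1.
Proof. by case: l; rewrite /= ?addr0 // addrC. Qed.

Lemma degree_vertex (u : vertex W) : degree (G k (W := W)) u = mdegree (val u).
Proof.
have -> : degree (G k (W := W)) u = \sum_(v : vertex W) weight (val u) (val v).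
  rewrite /degree big_mkcond; apply: eq_bigr => v _; rewrite -G_weight /adjacent.
  by case: eqP.
have := val_not_minus u; rewrite (big_vertex _ (weight (val u))).
move: (val u) => p p_signed.
have -> : \sum_i (weight p (i, Plus) +
     (if tnth W i is LE then 0 else weight p (i, X) + weight p (i, Y))) =
  \sum_i (weight p (i, Plus) + (weight p (i, X) + weight p (i, Y))).
  apply: eq_bigr => i _; case e : (tnth W i) => //.
  by rewrite (weight_noE _ (a := X) e) // (weight_noE _ (a := Y) e) // !addr0.
rewrite /mdegree; case: p p_signed => i [] //= _.
- rewrite !big_split /= (sum_if_pred1_sym i) (sum_if_pred1_sym (ord_pred i)).
  (* The vertex [(i, Plus)] is also the - vertex of the successor of i, the only j whose predecessor
     is i. *)
  have predE j : (ord_pred j == i) = (j == ordS i).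
    by rewrite (can2_eq (@ord_predK _) (@ordSK _)).
  under eq_bigr => j _ do rewrite predE.
  under [X in _ + (_ + X)]eq_bigr => j _ do rewrite predE.
  rewrite !sum_if_pred1.
  by rewrite addrACA !signedD_spoke; ring.
- by rewrite !big_split /= big1_eq add0r !sum_if_pred1_sym.
- by rewrite !big_split /= big1_eq addr0 !sum_if_pred1_sym.
Qed.

(** * From the normalized Laplacian to the block matrix *)

Hypothesis k_gt0 : 0 < k.

Lemma degree_gt0 (u : vertex W) : 0 < degree (G k (W := W)) u.
Proof.
rewrite degree_vertex; case: u => [[i a] /=].
rewrite in_vertex_set /mdegree /=; case: a => // [_|h|h].
  by rewrite mulr_gt0 ?addr_gt0.
all: move: h; case: (tnth W i) => //= _; rewrite ?addr0 ?addr_gt0 ?exprn_gt0 //.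
Qed.

Hypothesis t_gt1 : (1 < t)%N.

(** The two ends of a module stay distinct after gluing, so no loop reaches the diagonal. *)
Lemma ord_pred_neq (i : 'I_t) : (ord_pred i == i) = false.
Proof.
apply/negP => /eqP/(congr1 val) /=; have := ltn_ord i.
case: (nat_of_ord i) => [|m] lt_m.
  by rewrite modn_small ?prednK // ?ltn_predL; case: (t) t_gt1 => [|[]].
rewrite addSn succnK.
have -> : ((m + t) %% t = m)%N by rewrite modnDr modn_small // ltnW.
by move/eqP; rewrite eqn_leq ltnn andbF.
Qed.

(** Scaling rows and columns by the square roots of the degrees removes all radicals and leaves x -
    1 as the spectral parameter. *)
Lemma normalized_laplacian_weight (u v : vertex W) (x : R) :
  Num.sqrt (degree (G k (W := W)) u) *
   ((u == v)%:R * x - normalized_laplacian_entry (G k (W := W)) u v) *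
  Num.sqrt (degree (G k (W := W)) v) =
  if u == v then (x - 1) * mdegree (val u) else weight (val u) (val v).
Proof.
rewrite /normalized_laplacian_entry -degree_vertex; case: (eqVneq u v) => [<-|uv].
  have -> : isolated (G k (W := W)) u = false.
    apply/negP => /negP; rewrite negb_exists => /forallP iso.
    have := degree_gt0 u; rewrite /degree big1 ?ltxx // => v' adj.
    by have := iso v'; rewrite adj.
  by rewrite mul1r mulrAC -expr2 sqr_sqrtr ?ltW ?degree_gt0 // mulrC.
rewrite mul0r sub0r -G_weight /adjacent; case: eqP => [->|_] /=.
  by rewrite oppr0 mulr0 mul0r.
rewrite opprK sqrtrM ?ltW ?degree_gt0 //.
have su : Num.sqrt (degree (G k (W := W)) u) != 0 by rewrite sqrtr_eq0 -ltNge degree_gt0.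
have sv : Num.sqrt (degree (G k (W := W)) v) != 0 by rewrite sqrtr_eq0 -ltNge degree_gt0.
by field; rewrite su sv.
Qed.

(** Sends e_i to the basis vector of the preceding index, the representative of the - vertex of
    module i. *)
Definition gluing_mx : 'M[R]_t := \matrix_(j, i) (j == ord_pred i)%:R.

Lemma gluing_mx_orthogonal : gluing_mx *m gluing_mx^T = 1%:M.
Proof.
have -> : gluing_mx = (perm_mx (perm (@ord_pred_inj t)))^T.
  by apply/matrixP => i j; rewrite !mxE permE eq_sym.
by rewrite trmxK tr_perm_mx -perm_mxM mulVg perm_mx1.
Qed.

Definition outer_diag (z : R) (l : letter) : R :=
  if l is LE then 1 else z * (spoke_weight l + outer_weight l).

(* The missing vertices [X] and [Y] of the modules [E] are added with the identity
   as their block, which does not change the determinant. *)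
Definition padded_mx (z : R) : 'M[R]_(t + (t + t)) :=
  module_mx gluing_mx (fun=> z * (k + 1)) (fun i => signed_weight (tnth W i))
    (fun i => spoke_weight (tnth W i)) (fun i => outer_diag z (tnth W i))
    (fun i => outer_weight (tnth W i)).

Definition pair_index (p : 'I_t * mvertex) : 'I_(t + (t + t)) :=
  match p.2 with
  | X => rshift t (lshift t p.1)
  | Y => rshift t (rshift t p.1)
  | _ => lshift (t + t) p.1
  end.

Definition vertex_index (v : vertex W) := pair_index (val v).

Lemma vertex_index_inj : injective vertex_index.
Proof.
move=> u v; rewrite /vertex_index => e; apply: val_inj; move: e.
have := val_not_minus v; have := val_not_minus u.
case: (val u) (val v) => [i []] [j []] //= _ _; rewrite /pair_index /=.
all: by move/eqP; rewrite ?(eq_lrshift, eq_rlshift, eq_rshift, eq_lshift) => // /eqP->.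
Qed.

Lemma codom_vertex_index p : p \in vertex_set W -> pair_index p \in codom vertex_index.
Proof. by move=> pW; apply/codomP; exists (Sub p pW); rewrite /vertex_index SubK. Qed.

(** The constant diagonal b commutes with the gluing and is counted twice, as each signed vertex
    lies in two modules. *)
Lemma ring_gluing_mxE b a i j :
  ring_mx gluing_mx (fun=> b) a i j =
  if i == j then 2 * b else
   (if ord_pred i == j then a i else 0) + (if ord_pred j == i then a j else 0).
Proof.
rewrite /ring_mx.
have -> : dmx (fun=> b : R) = b%:M :> 'M[R]_t.
  by rewrite -diag_const_mx; congr diag_mx; apply/rowP => l; rewrite !mxE.
rewrite mul_mx_scalar -scalemxAl gluing_mx_orthogonal mul_diag_mx mul_mx_diag !mxE.
case: eqVneq => [->|ij].
  by rewrite eq_sym ord_pred_neq /=; ring.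
rewrite [j == _]eq_sym [i == ord_pred j]eq_sym.
by do 2 case: eqP => _; rewrite /=; ring.
Qed.

Lemma padded_mxE z (u v : vertex W) :
  padded_mx z (vertex_index u) (vertex_index v) =
  if u == v then z * mdegree (val u) else weight (val u) (val v).
Proof.
rewrite -val_eqE /vertex_index /padded_mx /module_mx.
case: u v => [[i a] hu] [[j b] hv] /=; move: hu hv; rewrite !in_vertex_set.
rewrite /pair_index /mdegree xpair_eqE /=; case: a => // hu; case: b => // hv /=.
all: rewrite ?block_mx_entriesE ?ring_gluing_mxE ?mul_mx_diag ?mul_diag_mx ?mxE.
all: rewrite ?andbT ?andbF ?[_ == ord_pred _]eq_sym //=.
- by case: eqP => // _; ring.
- by case: eqP => [->|].
- by case: eqP; rewrite (mul1r, mul0r).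
- by case: eqP.
(* [hu] excludes [LE], where [outer_diag] takes its padding value 1. *)
- by case: eqP hu => // _; case: (tnth W i).
- by case: eqP.
- by case: eqP; rewrite (mulr1, mulr0).
- by case: eqP.
- by case: eqP hu => // _; case: (tnth W i).
Qed.

(** An index outside the image is an X or Y of a module [LE]: its spoke and outer weights are 0 and
    its diagonal entry is 1. *)
Lemma padded_mx_pad z x y : x \notin codom vertex_index ->
  padded_mx z x y = (x == y)%:R /\ padded_mx z y x = (x == y)%:R.
Proof.
have notin_LE i a : pair_index (i, a) \notin codom vertex_index ->
    a \in [:: X; Y] -> tnth W i = LE.
  move=> /(contra (@codom_vertex_index _)); rewrite in_vertex_set.
  by case: a; rewrite // !inE; case: (tnth W i).
case: (split_ordP x) => x' ->.
  by rewrite (codom_vertex_index (p := (x', Plus))) ?in_vertex_set.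
rewrite /padded_mx /module_mx.
case: (split_ordP x') => i -> {x'} iW.
  have Wi : tnth W i = LE by apply: (notin_LE i X).
  case: (split_ordP y) => y' ->; last case: (split_ordP y') => j -> {y'};
  rewrite ?block_mx_entriesE ?mul_mx_diag ?mul_diag_mx ?mxE ?Wi;
  rewrite ?(eq_lrshift, eq_rlshift, eq_rshift, eq_lshift) ?(eq_sym _ i);
  by split; case: eqP => [e|_]; rewrite -?e ?Wi ?mulr0 ?mul0r ?mul0rn.
have Wi : tnth W i = LE by apply: (notin_LE i Y).
case: (split_ordP y) => y' ->; last case: (split_ordP y') => j -> {y'};
rewrite ?block_mx_entriesE ?mul_mx_diag ?mul_diag_mx ?mxE ?Wi;
rewrite ?(eq_lrshift, eq_rlshift, eq_rshift, eq_lshift) ?(eq_sym _ i);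
by split; case: eqP => [e|_]; rewrite -?e ?Wi ?mulr0 ?mul0r ?mul0rn.
Qed.

(** The prefactor is the product of all degrees, from the scaling on both sides: module i accounts
    for its + vertex and, unless it is [LE], for X and Y. *)
Lemma char_poly_normalized_laplacian (x : R) :
  (\prod_i (2 * (k + 1) * (if tnth W i is LE then 1
     else (spoke_weight (tnth W i) + outer_weight (tnth W i)) ^+ 2))) *
  (char_poly (normalized_laplacian (G k (W := W)))).[x] = \det (padded_mx (x - 1)).
Proof.
rewrite (det_pad_identity vertex_index_inj (padded_mx_pad (x - 1))).
rewrite horner_char_poly.
pose D := diag_mx (\row_(i < #|vertex W|) Num.sqrt (degree (G k (W := W)) (enum_val i))).
set M := \matrix_(i, j) _.
have -> : M = D *m (x%:M - normalized_laplacian (G k (W := W))) *m D.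
  apply/matrixP => i j; rewrite mul_mx_diag mul_diag_mx /M [LHS]mxE padded_mxE.
  rewrite -normalized_laplacian_weight (inj_eq enum_val_inj) !mxE.
  by rewrite mulr_natl.
rewrite !det_mulmx mulrAC -det_mulmx; congr (_ * _).
rewrite mulmx_diag det_diag.
transitivity (\prod_(v : vertex W) mdegree (val v)).
  rewrite (big_vertex _ mdegree); apply: eq_bigr => i _; rewrite /mdegree /=.
  by case: (tnth W i); rewrite // mulr1.
rewrite (reindex (@enum_val _ (vertex W))) /=.
  by apply: eq_bigr => i _; rewrite !mxE -expr2 sqr_sqrtr ?ltW ?degree_gt0 ?degree_vertex.
exact/onW_bij/enum_val_bij.
Qed.

End LetterWeights.

(** * The effect of toggling on a single letter *)

Section LetterIdentities.
Variables (R : rcfType) (k z : R).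
Hypotheses (k_gt0 : 0 < k) (z_gt1 : 1 < z).

(** Determinant of the block on X and Y; the next two definitions are the entries of the Schur
    complement of the module. *)
Definition outer_det (l : letter) : R := outer_diag k z l ^+ 2 - outer_weight k l ^+ 2.
Definition reduced_diag (l : letter) : R :=
  z * (k + 1) - spoke_weight k l ^+ 2 * outer_diag k z l / outer_det l.
Definition reduced_off (l : letter) : R :=
  signed_weight k l + spoke_weight k l ^+ 2 * outer_weight k l / outer_det l.
Definition degree_prod (l : letter) : R :=
  2 * (k + 1) * (if l is LE then 1 else (spoke_weight k l + outer_weight k l) ^+ 2).

Let k0 : k != 0. Proof. by rewrite gt_eqF. Qed.
Let k10 : k + 1 != 0. Proof. by rewrite gt_eqF // addr_gt0. Qed.
Let z_gt0 : 0 < z. Proof. exact: lt_trans z_gt1. Qed.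
Let z0 : z != 0. Proof. by rewrite gt_eqF. Qed.
Let zz0 : z ^+ 2 - 1 != 0.
Proof. by rewrite gt_eqF // subr_gt0 expr_gt1 // ltW. Qed.
Let zk0' : (z * (k + 1)) ^+ 2 - k ^+ 2 != 0.
Proof.
have zk : k < z * (k + 1).
  by rewrite (@lt_trans _ _ (k + 1)) ?ltrDl ?ltr_pMl ?addr_gt0.
rewrite gt_eqF // subr_sqr mulr_gt0 ?subr_gt0 //.
by rewrite addr_gt0 // (lt_trans k_gt0).
Qed.

Let zk0 : z ^+ 2 * (k + 1) ^+ 2 - k ^+ 2 != 0. Proof. by rewrite -exprMn. Qed.

Let outer_detE l : outer_det l = match l with LP => z ^+ 2 * k ^+ 2
  | LC => k ^+ 2 * (z ^+ 2 * (k + 1) ^+ 2 - k ^+ 2) | LE => 1 end.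
Proof. by rewrite /outer_det; case: l => /=; ring. Qed.

Lemma outer_det_neq0 l : outer_det l != 0.
Proof. by rewrite outer_detE; case: l; rewrite ?mulf_neq0 ?expf_neq0 ?oner_neq0. Qed.

Lemma degree_prod_neq0 l : degree_prod l != 0.
Proof.
rewrite gt_eqF // /degree_prod; case: l;
by rewrite /= ?mulr_gt0 ?exprn_gt0 ?addr0 ?addr_gt0 ?exprn_gt0.
Qed.

(** The values at [LP] and [LC] multiply to [dual_scale ^+ 2] and the value at [LE] is [dual_scale],
    as the duality d -> e^2/d demands. *)
Let reduced_detE l : reduced_diag l ^+ 2 - reduced_off l ^+ 2 =
  match l with
  | LP => (z ^+ 2 - 1) * (z ^+ 2 * (k + 1) ^+ 2 - k ^+ 2) / z ^+ 2
  | LC => (z ^+ 2 - 1) * z ^+ 2 * (k + 1) ^+ 4 / (z ^+ 2 * (k + 1) ^+ 2 - k ^+ 2)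
  | LE => (k + 1) ^+ 2 * (z ^+ 2 - 1)
  end.
Proof.
rewrite /reduced_diag /reduced_off outer_detE; case: l => /=; field;
by rewrite ?k0 ?z0 ?zk0 ?zk0'.
Qed.

Lemma reduced_det_neq0 l : reduced_diag l ^+ 2 - reduced_off l ^+ 2 != 0.
Proof.
by rewrite reduced_detE; case: l; rewrite !mulf_neq0 ?invr_neq0 ?expf_neq0.
Qed.

Definition dual_scale : R := (k + 1) ^+ 2 * (z ^+ 2 - 1).

Lemma dual_scale_neq0 : dual_scale != 0.
Proof. by rewrite mulf_neq0 ?expf_neq0. Qed.

(** With its companion for [reduced_off], this identifies toggling with the duality: the block
    divided by its determinant and scaled by [dual_scale] is the toggled block. *)
Lemma reduced_diag_toggle l :
  reduced_diag (toggle_letter l) * (reduced_diag l ^+ 2 - reduced_off l ^+ 2) =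
  dual_scale * reduced_diag l.
Proof.
rewrite reduced_detE /reduced_diag /dual_scale !outer_detE; case: l => /=; field;
by rewrite ?k0 ?z0 ?zk0 ?zk0'.
Qed.

Lemma reduced_off_toggle l :
  reduced_off (toggle_letter l) * (reduced_diag l ^+ 2 - reduced_off l ^+ 2) =
  dual_scale * reduced_off l.
Proof.
rewrite reduced_detE /reduced_off /dual_scale !outer_detE; case: l => /=; field;
by rewrite ?k0 ?z0 ?zk0 ?zk0'.
Qed.

(** The scalars produced by elimination, duality and degree scaling balance letter by letter. *)
Lemma normalizer_toggle l :
  outer_det l * (reduced_diag l ^+ 2 - reduced_off l ^+ 2) *
    degree_prod (toggle_letter l) =
  dual_scale * (outer_det (toggle_letter l) * degree_prod l).
Proof.
rewrite reduced_detE /degree_prod /dual_scale !outer_detE; case: l => /=; field;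
by rewrite ?k0 ?z0 ?zk0 ?zk0'.
Qed.

(** * Comparison of the two characteristic polynomials *)

Variables (t : nat) (t_gt1 : (1 < t)%N).

Lemma char_poly_reduced (W : t.-tuple letter) :
  (\prod_i degree_prod (tnth W i)) *
    (char_poly (normalized_laplacian (G k (W := W)))).[z + 1] =
  (\prod_i outer_det (tnth W i)) *
    \det (ring_mx (gluing_mx R t) (fun i => reduced_diag (tnth W i))
                  (fun i => reduced_off (tnth W i))).
Proof.
rewrite char_poly_normalized_laplacian // addrK /padded_mx det_module_mx // => i.
exact: outer_det_neq0.
Qed.

Lemma char_poly_toggle_horner (W : t.-tuple letter) :
  (char_poly (normalized_laplacian (G k (W := W)))).[z + 1] =
  (char_poly (normalized_laplacian (G k (W := toggle W)))).[z + 1].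
Proof.
have := char_poly_reduced W; have := char_poly_reduced (toggle W).
under eq_bigr => i _ do rewrite tnth_map.
under [in RHS]eq_bigr => i _ do rewrite tnth_map.
set x' := (_).[_]; set x := (_).[_].
set D' := \det _; set D := \det _ => E' E.
have two_neq0 : 2%:R != 0 :> R by rewrite pnatr_eq0.
have DD' : dual_scale ^+ t * D =
    (\prod_i (reduced_diag (tnth W i) ^+ 2 - reduced_off (tnth W i) ^+ 2)) * D'.
  apply: det_ring_mx_toggle => //; first exact: gluing_mx_orthogonal.
  - exact: dual_scale_neq0.
  - by move=> i; apply: reduced_det_neq0.
  - by move=> i; rewrite tnth_map; apply: reduced_diag_toggle.
  - by move=> i; rewrite tnth_map; apply: reduced_off_toggle.
have norm : (\prod_i outer_det (tnth W i)) *
    (\prod_i (reduced_diag (tnth W i) ^+ 2 - reduced_off (tnth W i) ^+ 2)) *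
    (\prod_i degree_prod (toggle_letter (tnth W i))) =
  dual_scale ^+ t * ((\prod_i outer_det (toggle_letter (tnth W i))) *
    (\prod_i degree_prod (tnth W i))).
  have -> : dual_scale ^+ t = \prod_(i < t) dual_scale by rewrite prodr_const card_ord.
  by rewrite -!big_split; apply: eq_bigr => i _; apply: normalizer_toggle.
have prod_neq0 (F : 'I_t -> R) : (forall i, F i != 0) -> \prod_i F i != 0.
  by move=> F0; apply/prodf_neq0 => i _.
have e0 := expf_neq0 t dual_scale_neq0.
have d0 := prod_neq0 _ (fun i => degree_prod_neq0 (tnth W i)).
have d'0 := prod_neq0 _ (fun i => degree_prod_neq0 (toggle_letter (tnth W i))).
(* Multiplying by both degree products and by [dual_scale ^+ t] lets [E], [E'], [DD'] and [norm]
   apply without division. *)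
apply: (mulfI d0); apply: (mulfI d'0); apply: (mulfI e0).
rewrite E mulrCA [_ ^+ t * (_ * D)]mulrCA DD'.
rewrite [X in _ = _ * X]mulrCA E'.
move: norm; set a := \prod_i outer_det _; set b := \prod_i (_ - _).
set c := \prod_i _; set d := \prod_i outer_det _; set f := \prod_i _ => norm.
transitivity ((a * b * c) * D'); first ring.
rewrite norm; ring.
Qed.

End LetterIdentities.

Theorem theorem2p3 (R : rcfType) (k : R) (hk : 0 < k) (tau : nat)
  (htau : (3 <= tau)%N) (W : tau.-tuple letter) :
  cospectral (G k (W := W)) (G k (W := toggle W)).
Proof.
(* For x > 2 the parameter z = x - 1 exceeds 1, so z, z^2 - 1 and z^2 (k+1)^2 - k^2 are nonzero. *)
apply: (@eq_poly_gt _ 2) => x x_gt2; rewrite -[x](subrK 1).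
by apply: char_poly_toggle_horner; rewrite ?(ltnW htau) //; lra.
Qed.
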